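(* Let $\mathbb{X}$ be a reflexive Banach space and let $V$ be an isometry on $\mathbb{X}$. Then the following are equivalent: (i) $V$ has right-complemented range; (ii) there is an operator $T:\mathbb{X}\to\mathbb{X}$ with $\|T\|=1$ such that $TV=I$.
   Context: All Banach spaces are over the complex field. An isometry on $\mathbb{X}$ is a linear map $V:\mathbb{X}\to\mathbb{X}$ with $\|Vx\|=\|x\|$ for all $x$ (not necessarily onto). ''Operator'' means bounded linear operator, and $I$ is the identity operator on $\mathbb{X}$. Birkhoff-James orthogonality: $x\perp_B y$ means $\|x+\lambda y\|\ge\|x\|$ for all $\lambda\in\mathbb{C}$; for subspaces, $\mathbb{Y}\perp_B\mathbb{Z}$ means $y\perp_B z$ for all $y\in\mathbb{Y}$, $z\in\mathbb{Z}$. A closed linear subspace $\mathbb{Y}$ of $\mathbb{X}$ is right-complemented if there is a closed linear subspace $\widetilde{\mathbb{Y}}$ of $\mathbb{X}$ which is a vector space complement of $\mathbb{Y}$ and satisfies $\mathbb{Y}\perp_B\widetilde{\mathbb{Y}}$. *)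

(* Defs.v *)
From HB Require Import structures.
From mathcomp Require Import all_boot all_order all_algebra.
From mathcomp Require Import boolp classical_sets functions reals topology.
From mathcomp Require Import normedtype.
From mathcomp Require Import complex.

Set Implicit Arguments.
Unset Strict Implicit.
Unset Printing Implicit Defensive.

Import Order.TTheory GRing.Theory Num.Theory.
Import numFieldNormedType.Exports.

Local Open Scope classical_set_scope.
Local Open Scope ring_scope.

(* Complex Banach spaces are [completeNormedModType R[i]], with R a realType.
   Norms therefore take values in R[i]; they are nonnegative there, hence real,
   and the order of R[i] restricted to reals is the order of R. *)

Definition bounded_linear (R : realType) (X Y : normedModType R[i]) :
    {pred X -> Y} :=
  mem [set T : X -> Y | linear T /\
         exists M : R[i], forall x, `|T x| <= M * `|x|].

Record boundedOp (R : realType) (X Y : normedModType R[i]) := BoundedOp {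
  bop_fun :> X -> Y;
  bop_funP : bop_fun \in @bounded_linear R X Y }.

Definition opnorm (R : realType) (X Y : normedModType R[i]) (T : X -> Y) : R :=
  sup [set complex.Re `|T x| | x in [set x : X | `|x| <= 1]].

HB.instance Definition _ (R : realType) (X Y : normedModType R[i]) :=
  [isSub for @bop_fun R X Y].
HB.instance Definition _ (R : realType) (X Y : normedModType R[i]) :=
  [Choice of boundedOp X Y by <:].

Lemma bounded_linearP (R : realType) (X Y : normedModType R[i]) (T : X -> Y) :
  reflect (linear T /\ exists M : R[i], forall x, `|T x| <= M * `|x|)
          (T \in @bounded_linear R X Y).
Proof. by apply: (iffP idP); rewrite /bounded_linear ?inE. Qed.

Lemma bounded_linear_submod_closed (R : realType) (X Y : normedModType R[i]) :
  submod_closed (@bounded_linear R X Y).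
Proof.
split.
  apply/bounded_linearP; split=> [a x y|]; first by rewrite /= scaler0 addr0.
  by exists 0 => x; rewrite mul0r normr0.
move=> a S T /bounded_linearP[linS [M SM]] /bounded_linearP[linT [N TN]].
apply/bounded_linearP; split=> [b x y|].
  rewrite !fctE linS linT !scalerDr !scalerA (mulrC a b) !addrA.
  by congr (_ + _); rewrite -!addrA; congr (_ + _); rewrite addrC.
exists (`|a| * M + N) => x; rewrite fctE.
apply: (le_trans (ler_normD _ _)); rewrite mulrDl lerD ?TN//.
by rewrite normrZ -mulrA ler_wpM2l.
Qed.

HB.instance Definition _ (R : realType) (X Y : normedModType R[i]) :=
  GRing.isSubmodClosed.Build R[i] (X -> Y) (@bounded_linear R X Y)
    (@bounded_linear_submod_closed R X Y).
HB.instance Definition _ (R : realType) (X Y : normedModType R[i]) :=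
  [SubChoice_isSubLmodule of boundedOp X Y by <:].

Lemma bop_linear (R : realType) (X Y : normedModType R[i])
  (T : boundedOp X Y) : linear T.
Proof. by have /bounded_linearP[] := bop_funP T. Qed.

HB.instance Definition _ (R : realType) (X Y : normedModType R[i])
  (T : boundedOp X Y) := GRing.isLinear.Build R[i] X Y *:%R T (bop_linear T).

Lemma Re_normK (R : realType) (X : normedModType R[i]) (x : X) :
  ((complex.Re `|x|)%:C)%C = `|x|.
Proof. by rewrite RRe_real ?normr_real. Qed.

Lemma opnorm_ub (R : realType) (X Y : normedModType R[i]) (T : boundedOp X Y) :
  has_ubound [set complex.Re `|T x| | x in [set x : X | `|x| <= 1]].
Proof.
have /bounded_linearP[_ [M TM]] := bop_funP T.
exists (complex.Re `|M|) => _ [x /= x1 <-].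
rewrite -lecR !Re_normK (le_trans (TM x))//.
apply: (@le_trans _ _ (`|M| * `|x|)); last by rewrite ler_piMr.
have [->|x0] := eqVneq x 0; first by rewrite normr0 !mulr0.
have nx : 0 < `|x| by rewrite normr_gt0.
by rewrite ger0_norm// -(pmulr_lge0 _ nx) (le_trans _ (TM x)).
Qed.

Lemma opnorm_ge0 (R : realType) (X Y : normedModType R[i])
  (T : boundedOp X Y) : 0 <= opnorm T.
Proof.
apply: (ub_le_sup (opnorm_ub T)); exists 0; first by rewrite /= normr0 ler01.
by rewrite linear0 normr0.
Qed.

Lemma opnorm_le (R : realType) (X Y : normedModType R[i])
  (T : boundedOp X Y) (x : X) : `|T x| <= ((opnorm T)%:C)%C * `|x|.
Proof.
have [->|x0] := eqVneq x 0; first by rewrite linear0 !normr0 mulr0.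
have nx : `|x| != 0 by rewrite normr_eq0.
rewrite -ler_pdivrMr ?normr_gt0//.
have -> : `|T x| / `|x| = `|T (`|x|^-1 *: x)|.
  by rewrite linearZ normrZ normfV normr_id mulrC.
rewrite -Re_normK lecR; apply: (ub_le_sup (opnorm_ub T)).
exists (`|x|^-1 *: x) => //=.
by rewrite normrZ normfV normr_id mulVf.
Qed.

Lemma opnorm_bound (R : realType) (X Y : normedModType R[i])
  (T : X -> Y) (M : R) : 0 <= M ->
  (forall x, `|T x| <= (M%:C)%C * `|x|) -> opnorm T <= M.
Proof.
move=> M0 TM; apply: ge_sup.
  by exists (complex.Re `|T 0|), 0 => //=; rewrite normr0 ler01.
move=> _ [x /= x1 <-]; rewrite -lecR Re_normK (le_trans (TM x))//.
by rewrite ler_piMr// ler0c.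
Qed.

Lemma opnormD (R : realType) (X Y : normedModType R[i]) (S T : boundedOp X Y) :
  ((opnorm (S + T))%:C <= (opnorm S)%:C + (opnorm T)%:C)%C.
Proof.
rewrite -rmorphD/= lecR; apply: opnorm_bound; first by rewrite addr_ge0 ?opnorm_ge0.
move=> x; rewrite rmorphD/= mulrDl.
by rewrite (le_trans (ler_normD _ _))// lerD ?opnorm_le.
Qed.

Lemma opnormZ_le (R : realType) (X Y : normedModType R[i]) (a : R[i])
  (T : boundedOp X Y) : ((opnorm (a *: T))%:C <= `|a| * (opnorm T)%:C)%C.
Proof.
rewrite -(@Re_normK R R[i]^o a) -rmorphM/= lecR; apply: opnorm_bound => [|x].
  apply: mulr_ge0; last exact: opnorm_ge0.
  by rewrite -ler0c (@Re_normK R R[i]^o).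
rewrite rmorphM/= (@Re_normK R R[i]^o) [leLHS]normrZ -mulrA.
by rewrite ler_wpM2l ?opnorm_le.
Qed.

Lemma opnormZ (R : realType) (X Y : normedModType R[i]) (a : R[i])
  (T : boundedOp X Y) : ((opnorm (a *: T))%:C = `|a| * (opnorm T)%:C)%C.
Proof.
apply/eqP; rewrite eq_le opnormZ_le andTb.
have [->|a0] := eqVneq a 0; first by rewrite normr0 mul0r lecR; exact: opnorm_ge0.
rewrite -ler_pdivlMl ?normr_gt0// -normfV.
by have := opnormZ_le a^-1 (a *: T); rewrite scalerA mulVf// scale1r.
Qed.

Lemma opnorm0_eq0 (R : realType) (X Y : normedModType R[i])
  (T : boundedOp X Y) : ((opnorm T)%:C)%C = 0 -> T = 0.
Proof.
move=> T0; apply/val_inj/funext => x /=; apply/eqP.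
by rewrite -normr_eq0 eq_le normr_ge0 andbT (le_trans (opnorm_le T x))// T0 mul0r.
Qed.

HB.instance Definition _ (R : realType) (X Y : normedModType R[i]) :=
  Lmodule_isNormed.Build R[i] (boundedOp X Y)
    (@opnormD R X Y) (@opnormZ R X Y) (@opnorm0_eq0 R X Y).

Definition dual_space (R : realType) (X : normedModType R[i]) : normedModType R[i] :=
  boundedOp X R[i]^o.

(* The canonical embedding of X into its bidual is onto. *)
Definition reflexive_space (R : realType) (X : normedModType R[i]) :=
  forall Phi : dual_space (dual_space X),
    exists x : X, forall f : dual_space X, Phi f = f x.

Definition linear_isometry (R : realType) (X : normedModType R[i])
    (V : {linear X -> X}) :=
  forall x, `|V x| = `|x|.

Definition birkhoff_james (R : realType) (X : normedModType R[i]) (x y : X) :=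
  forall l : R[i], `|x| <= `|x + l *: y|.

Definition closed_subspace (R : realType) (X : normedModType R[i])
    (Y : set X) :=
  submod_closed (mem Y) /\ closed Y.

Definition vs_complement (R : realType) (X : normedModType R[i])
    (Y Z : set X) :=
  (forall x, exists y z, [/\ Y y, Z z & x = y + z]) /\ Y `&` Z = [set 0].

Definition right_complemented (R : realType) (X : normedModType R[i])
    (Y : set X) :=
  closed_subspace Y /\
  exists Z : set X, [/\ closed_subspace Z, vs_complement Y Z
    & forall y z, Y y -> Z z -> birkhoff_james y z].

(* Main.v *)
Require Import Defs.
From mathcomp Require Import all_boot all_order all_algebra.
From mathcomp Require Import boolp classical_sets functions reals topology.
From mathcomp Require Import normedtype.
From mathcomp Require Import complex.

Import Order.TTheory GRing.Theory Num.Theory.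
Import numFieldNormedType.Exports.

Local Open Scope classical_set_scope.
Local Open Scope ring_scope.

(** The two conditions correspond through the projection [V \o T] onto the
    range of [V]: Birkhoff-James orthogonality of the range to a complement [Z]
    says exactly that the projection along [Z] is contractive.  Given [Z], take
    [T] to be this projection followed by the inverse of [V] on its range; given
    [T], take [Z] to be the kernel of [T]. *)

(** The bound makes [f] continuous, and the kernel is the preimage of the closed set [[set 0]]. *)
Lemma closed_subspace_ker (R : realType) (X Y : normedModType R[i])
    (f : {linear X -> Y}) (M : R[i]) :
  0 <= M -> (forall x, `|f x| <= M * `|x|) ->
  closed_subspace [set x | f x = 0].
Proof.
move=> M0 fM; split.
  split=> [|a x y]; rewrite !inE /= ?linear0// => fx fy.
  by rewrite linearP fx fy scaler0 addr0.
have fcont : continuous f.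
  apply: bounded_linear_continuous; apply/linear_boundedP.
  near=> r => x; apply: (le_trans (fM x)); apply: ler_wpM2r => //.
  by near: r; apply: nbhs_pinfty_ge; rewrite ger0_real.
apply: (@preimage_closed _ _ f [set 0]); first by move=> x _; exact: fcont.
exact/accessible_closed_set1/hausdorff_accessible/norm_hausdorff.
Unshelve. all: by end_near. Qed.

(** Contractivity bounds the norm above by 1; the nonzero vector [x], whose length is preserved,
    bounds it below. *)
Lemma opnorm_eq1 (R : realType) (X Y : normedModType R[i])
    (T : boundedOp X Y) (x : X) :
  x != 0 -> `|T x| = `|x| -> (forall y, `|T y| <= `|y|) -> `|T| = 1.
Proof.
move=> x0 Tx Tle; apply/le_anti/andP; split.
  rewrite -[leRHS]/((1%:C)%C) lecR; apply: opnorm_bound => // y.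
  by rewrite mul1r.
rewrite -(@ler_pM2r _ `|x|) ?normr_gt0// mul1r -{1}Tx.
exact: opnorm_le.
Qed.

Lemma right_complemented_range_left_inverse (R : realType)
    (X : normedModType R[i]) (V : {linear X -> X}) :
  linear_isometry V -> right_complemented (range V) ->
  exists T : boundedOp X X, (forall x, `|T x| <= `|x|) /\ T \o V = id.
Proof.
move=> hV [_ [Z [[[Z0 Zlin] _] [dec VZ0] orth]]].
have {}Z0 : Z 0 by rewrite inE in Z0.
have {}Zlin a z w : Z z -> Z w -> Z (a *: z + w).
  by move=> Zz Zw; have := Zlin a z w; rewrite !inE; exact.
have decV x : exists u, Z (x - V u).
  have [_ [z [[u _ <-] Zz ->]]] := dec x; exists u.
  by rewrite addrAC subrr add0r.
have [t Zt] := choice decV.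
(* The difference of two decompositions of [x] lies in [range V] and in [Z], so it vanishes, and [V]
   is injective. Linearity of the chosen [t] follows from this uniqueness. *)
have t_uniq x u : Z (x - V u) -> t x = u.
  move=> Zu; apply/eqP; rewrite -subr_eq0 -normr_eq0 -hV normr_eq0; apply/eqP.
  have : (range V `&` Z) (V (t x - u)).
    split; first by exists (t x - u).
    have := Zlin (-1) _ _ (Zt x) Zu.
    by rewrite scaleN1r opprB addrA subrK -linearB.
  by rewrite VZ0.
have t_lin : linear t.
  move=> a x y; apply: t_uniq.
  have := Zlin a _ _ (Zt x) (Zt y).
  by rewrite scalerBr -linearZ addrACA -opprD -linearD.
(* Orthogonality with scalar 1: adding [x - V (t x)] to [V (t x)] gives [x]. *)
have t_le x : `|t x| <= `|x|.
  have := orth (V (t x)) _ (imageP V I) (Zt x) 1.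
  by rewrite scale1r addrC subrK hV.
have t_bnd : t \in @bounded_linear R X X.
  by apply/bounded_linearP; split=> //; exists 1 => x; rewrite mul1r.
exists (BoundedOp t_bnd); split=> //; apply/funext => x /=.
by apply: t_uniq; rewrite subrr.
Qed.

Lemma left_inverse_right_complemented_range (R : realType)
    (X : normedModType R[i]) (V : {linear X -> X}) (T : boundedOp X X) :
  linear_isometry V -> (forall x, `|T x| <= `|x|) -> T \o V = id ->
  right_complemented (range V).
Proof.
move=> hV Tle TV; have {}TV x : T (V x) = x by rewrite -[RHS]/(id x) -TV.
(* As the kernel of a map bounded by 1 + 1 = 2, the range is closed. *)
have rangeE : range V = [set x | (idfun \- (V \o T)) x = 0].
  apply/seteqP; split=> [_ [x _ <-]|x] /=; first by rewrite TV subrr.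
  by move/subr0_eq => ->; exists (T x).
split.
  rewrite rangeE; apply: (@closed_subspace_ker _ _ _ _ 2) => // x.
  by rewrite (le_trans (ler_normB _ _))// mulr_natl mulr2n lerD2l /= hV.
exists [set x | T x = 0]; split.
- by apply: (@closed_subspace_ker _ _ _ T 1) => // x; rewrite mul1r Tle.
- split=> [x|].
    exists (V (T x)), (x - V (T x)); split=> /=; first by exists (T x).
      by rewrite linearB /= TV subrr.
    by rewrite addrC subrK.
  apply/seteqP; split=> [_ [[x _ <-]] /=|_ ->] /=.
    by rewrite TV => ->; rewrite linear0.
  by split; [exists 0; rewrite ?linear0 | rewrite linear0].
(* The contraction [T] sends [V x + l *: z] to [x]. *)
- move=> _ z [x _ <-] /= Tz l; rewrite hV.
  by have := Tle (V x + l *: z); rewrite linearD linearZ /= Tz scaler0 addr0 TV.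
Qed.

Theorem theorem1p6 (R : realType) (X : completeNormedModType R[i])
    (hX : exists x : X, x != 0) (hrefl : reflexive_space X)
    (V : {linear X -> X}) (hV : linear_isometry V) :
  right_complemented (range V) <->
  exists T : boundedOp X X, `|T| = 1 /\ T \o V = id.
Proof.
have [x x0] := hX; split.
  move=> /(right_complemented_range_left_inverse _ _ V hV)[T [Tle TV]].
  (* [T] preserves the length of the nonzero vector [V x], which it sends back to [x]. *)
  exists T; split=> //; apply: (@opnorm_eq1 _ _ _ _ (V x)) => //.
    by rewrite -normr_eq0 hV normr_eq0.
  by rewrite -[T (V x)]/((T \o V) x) TV hV.
move=> [T [T1 TV]]; apply: left_inverse_right_complemented_range hV _ TV.
by move=> y; rewrite -[leRHS]mul1r -T1; exact: opnorm_le.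
Qed.
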